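(* Let $(X,d,\mu)$ be an irreversible metric measure space. Then for every $0<\varepsilon<1$, $$\mathrm{ObsDiam}_{\mu}(X;\varepsilon)\le 2\,\alpha_{\mu}^{-1}\left(\frac{\varepsilon}{2}\right).$$
   Context: An irreversible metric space $(X,d)$ is a set $X$ with a function $d:X\times X\to[0,\infty)$ such that $d(x_1,x_2)=0$ if and only if $x_1=x_2$, and $d(x_1,x_3)\le d(x_1,x_2)+d(x_2,x_3)$ for all $x_1,x_2,x_3\in X$ ($d$ need not be symmetric). An irreversible metric measure space $(X,d,\mu)$ is an irreversible metric space endowed with a Borel probability measure $\mu$. For $A\subset X$ and $r>0$ put $B^{+}(A,r)=\{x\in X\mid \inf_{z\in A}d(z,x)<r\}$ and $B^{-}(A,r)=\{x\in X\mid \inf_{z\in A}d(x,z)<r\}$. The concentration function is $$\alpha_{\mu}(r)=\sup\left\{1-\min\{\mu(B^{+}(A,r)),\mu(B^{-}(A,r))\}\;\middle|\; A\subset X \text{ Borel},\ \mu(A)\ge \tfrac12\right\},\quad r>0,$$ and its generalized inverse is $\alpha_{\mu}^{-1}(\varepsilon)=\inf\{r>0\mid\alpha_\mu(r)\le\varepsilon\}$ for $\varepsilon>0$. $\mathrm{Lip}_1(X)$ denotes the set of 1-Lipschitz functions, i.e. $f:X\to\mathbb{R}$ with $f(z)-f(x)\le d(x,z)$ for all $x,z\in X$. The sets $B^{\pm}(A,r)$ and Lipschitz functions are understood to be measurable. For $0<\kappa<1$ the observable diameter is $$\mathrm{ObsDiam}_{\mu}(X;\kappa)=\sup_{f\in\mathrm{Lip}_1(X)}\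 \inf\{\mathrm{diam}(I)\mid I\subset\mathbb{R},\ \mu(f^{-1}(I))\ge1-\kappa\},$$ where $\mathrm{diam}(I)=\sup_{s,t\in I}|s-t|$ (that is, the supremum over $f\in \mathrm{Lip}_1(X)$ of the partial diameters of $\mathbb{R}$ with the push-forward measure $f_*\mu$). *)

(* Defs.v *)
From HB Require Import structures.
From mathcomp Require Import all_boot all_order all_algebra.
From mathcomp Require Import all_classical all_reals all_analysis.

Set Implicit Arguments.
Unset Strict Implicit.
Unset Printing Implicit Defensive.

Import Order.TTheory GRing.Theory Num.Theory.
Import numFieldNormedType.Exports.

Local Open Scope classical_set_scope.
Local Open Scope ring_scope.
Local Open Scope ereal_scope.

Record irreversible_metric (R : realType) (X : Type) (d : X -> X -> R) : Prop :=
  IrreversibleMetric {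
    irm_ge0 : forall x y, (0 <= d x y)%R ;
    irm_eq0 : forall x y, d x y = 0%R <-> x = y ;
    irm_triangle : forall x y z, (d x z <= d x y + d y z)%R }.

(* An asymmetric distance induces three topologies: those with neighbourhood
   bases the forward balls {y | d x y < r}, the backward balls
   {y | d y x < r}, and their intersections. *)
Variant ball_kind := Forward | Backward | Symmetrized.

Definition irm_ball (R : realType) (X : Type) (d : X -> X -> R) (k : ball_kind)
    (x : X) (r : R) : set X :=
  match k with
  | Forward => [set y | (d x y < r)%R]
  | Backward => [set y | (d y x < r)%R]
  | Symmetrized => [set y | (d x y < r)%R /\ (d y x < r)%R]
  end.

Definition irm_open (R : realType) (X : Type) (d : X -> X -> R) (k : ball_kind) :
    set (set X) :=
  [set U | forall x, U x -> exists2 r : R, (0 < r)%R & irm_ball d k x r `<=` U].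

(* B^+(A, r) and B^-(A, r); the infimum over the empty set is +oo. *)
Definition Bplus (R : realType) (X : Type) (d : X -> X -> R) (A : set X) (r : R) :
    set X :=
  [set x | ereal_inf [set (d z x)%:E | z in A] < r%:E].

Definition Bminus (R : realType) (X : Type) (d : X -> X -> R) (A : set X) (r : R) :
    set X :=
  [set x | ereal_inf [set (d x z)%:E | z in A] < r%:E].

Definition Lip1 (R : realType) (X : Type) (d : X -> X -> R) : set (X -> R) :=
  [set f | forall x z, (f z - f x <= d x z)%R].

(* The measurable sets of X are the Borel sets of one of the induced
   topologies. The measurability of B^+(A, r) and B^-(A, r) is a
   standing assumption: one of the two can fail to be open in the forward or
   the backward topology. *)
Record irreversible_mm_space (R : realType) (disp : measure_display)
    (X : measurableType disp) (d : X -> X -> R) (k : ball_kind) : Prop :=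
  IrreversibleMMSpace {
    irmm_metric : irreversible_metric d ;
    irmm_borel : @measurable disp X = <<s irm_open d k >> ;
    irmm_measurable_B : forall (A : set X) (r : R), measurable A -> (0 < r)%R ->
      measurable (Bplus d A r) /\ measurable (Bminus d A r) ;
    irmm_measurable_Lip1 : forall f : X -> R, Lip1 d f -> measurable_fun setT f }.

Definition concentration (R : realType) (disp : measure_display)
    (X : measurableType disp) (d : X -> X -> R) (mu : probability X R) (r : R) :
    \bar R :=
  ereal_sup [set 1 - mine (mu (Bplus d A r)) (mu (Bminus d A r)) |
             A in [set A : set X | measurable A /\ (2^-1)%:E <= mu A]].

Definition concentration_inv (R : realType) (disp : measure_display)
    (X : measurableType disp) (d : X -> X -> R) (mu : probability X R) (e : R) :
    \bar R :=
  ereal_inf [set r%:E | r in [set r : R | (0 < r)%R /\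
                                          concentration d mu r <= e%:E]].

(* This gives -oo on the empty set, which has measure 0 < 1 - kappa for
   kappa < 1 and so never enters [obs_diam]. *)
Definition diam (R : realType) (I : set R) : \bar R :=
  ereal_sup [set `|p.1 - p.2|%:E | p in I `*` I].

(* I ranges over the Borel subsets of the line, so that the pushforward
   measure of I is defined; replacing I by its closed convex hull keeps
   its diameter and does not decrease its measure, so the infimum is the same
   as over all I. *)
Definition obs_diam (R : realType) (disp : measure_display)
    (X : measurableType disp) (d : X -> X -> R) (mu : probability X R)
    (kappa : R) : \bar R :=
  ereal_sup
    [set ereal_inf [set diam I | I in [set I : set R |
            measurable I /\ (1 - kappa)%:E <= mu (f @^-1` I)]]
    | f in Lip1 d].

(* Main.v *)
(** Let [f] be 1-Lipschitz and [concentration d mu r <= eps / 2]. For every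
    [delta > 0] there are levels [t = s - delta < s] such that both [f <= s]
    and [f > t] have measure at least 1/2. On the forward [r]-neighbourhood of
    [f <= s] one has [f < s + r], on the backward [r]-neighbourhood of [f > t]
    one has [f > t - r], and each neighbourhood has measure at least
    [1 - eps / 2]. Hence [f] lies in an interval of length [2 r + delta] with
    probability at least [1 - eps]; let [delta] tend to 0. *)
Require Import Defs.
From HB Require Import structures.
From mathcomp Require Import all_boot all_order all_algebra.
From mathcomp Require Import all_classical all_reals all_analysis.
From mathcomp Require Import lra.
Import Order.TTheory GRing.Theory Num.Theory.
Import numFieldNormedType.Exports.
Local Open Scope classical_set_scope.
Local Open Scope ring_scope.
Local Open Scope ereal_scope.

(** Choose [s] among the levels where the cdf of [f] is at least 1/2, less than [delta] above their
    infimum. Then [s - delta] lies below the infimum, so the cdf there is under 1/2 and the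
    complement carries the rest. *)
Lemma exists_approx_median {R : realType} {disp : measure_display}
    {X : measurableType disp} (mu : probability X R) {f : X -> R} {delta : R} :
  measurable_fun setT f -> (0 < delta)%R ->
  exists s : R, (2^-1)%:E <= mu (f @^-1` `]-oo, s]) /\
                (2^-1)%:E <= mu (f @^-1` `](s - delta)%R, +oo[).
Proof.
move=> mf delta0.
pose Y : {RV mu >-> R} := mfun_Sub (mem_set mf).
have cdfE (t : R) : cdf Y t = mu (f @^-1` `]-oo, t]) by [].
pose S : set R := [set t | (2^-1)%:E <= cdf Y t].
have half_lt1 : (2^-1)%:E < 1 :> \bar R by rewrite lte_fin; lra.
have half_gt0 : 0 < (2^-1)%:E :> \bar R by rewrite lte_fin; lra.
(* The limits of the cdf, 1 at [+oo] and 0 at [-oo], make [S] nonempty and bounded below. Each limit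
   bound holds strictly beyond its [M], hence the witness [M + 1]. *)
have S_nonempty : S !=set0.
  have [M [_ hM]] := (cvg_cdfy1 Y) _ (open_ereal_gt' half_lt1).
  by exists (M + 1)%R; apply: ltW; apply: hM; rewrite ltrDl.
have S_lb : has_lbound S.
  have [M [_ hM]] := (cvg_cdfNy0 Y) _ (open_ereal_lt' half_gt0).
  exists M => t St; rewrite leNgt; apply/negP => /hM /=.
  by rewrite ltNge; apply/negP; rewrite negbK.
have [s Ss s_lt] := inf_adherent delta0 (conj S_nonempty S_lb).
exists s; split; first by rewrite -cdfE.
have /negP : ~ S (s - delta)%R.
  by move=> /(ge_inf S_lb); apply/negP; rewrite -ltNge ltrBlDr.
rewrite -ltNge cdfE => lt_half.
have -> : f @^-1` `](s - delta)%R, +oo[ = ~` (f @^-1` `]-oo, (s - delta)%R]).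
  by rewrite preimage_setC setCitvl.
have mA : measurable (f @^-1` `]-oo, (s - delta)%R]).
  by rewrite -[X in measurable X]setTI; apply: (mf measurableT).
rewrite probability_setC//; move: lt_half.
rewrite -(fineK (fin_num_measure mu _ mA)) -EFinB lte_fin lee_fin.
lra.
Qed.

(** Union bound for the complements of [A] and [B]. *)
Lemma probability_setI_ge {R : realType} {disp : measure_display}
    {X : measurableType disp} (mu : probability X R) {A B : set X} {a b : R} :
  measurable A -> measurable B ->
  (1 - a)%:E <= mu A -> (1 - b)%:E <= mu B ->
  (1 - (a + b))%:E <= mu (A `&` B).
Proof.
move=> mA mB.
have mI := measurableI _ _ mA mB.
have /= := measureU2 mu (measurableC mA) (measurableC mB).
rewrite -setCI !probability_setC//.
rewrite -(fineK (fin_num_measure mu _ mA)) -(fineK (fin_num_measure mu _ mB)).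
rewrite -(fineK (fin_num_measure mu _ mI)) -!EFinB -EFinD !lee_fin.
lra.
Qed.

Lemma diam_itvoo {R : realType} (a b : R) : diam `]a, b[ <= (b - a)%:E.
Proof.
apply: ge_ereal_sup => _ [[x y]] /= [+ +] <-.
rewrite !in_itv/= lee_fin ler_norml => /andP[ax xb] /andP[ay yb].
by apply/andP; split; lra.
Qed.

(** [A] competes in the supremum, and a lower bound on the minimum of two measures bounds both. *)
Lemma concentration_Bplus_Bminus {R : realType} {disp : measure_display}
    {X : measurableType disp} {d : X -> X -> R} {k : ball_kind}
    {mu : probability X R} {A : set X} {r e : R} :
  irreversible_mm_space d k -> (0 < r)%R -> concentration d mu r <= e%:E ->
  measurable A -> (2^-1)%:E <= mu A ->
  (1 - e)%:E <= mu (Bplus d A r) /\ (1 - e)%:E <= mu (Bminus d A r).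
Proof.
move=> hX r0 hr mA hA; apply/andP.
have [mp mm] := irmm_measurable_B hX mA r0.
have : 1 - mine (mu (Bplus d A r)) (mu (Bminus d A r)) <= e%:E.
  by apply: le_trans hr; apply: ereal_sup_ubound; exists A.
rewrite -(fineK (fin_num_measure mu _ mp)) -(fineK (fin_num_measure mu _ mm)).
by rewrite -EFin_min -EFinB !lee_fin lerBlDr addrC -lerBlDr le_min.
Qed.

(** [Lip1] limits the increase of [f] along [d z x], so going forward from [z] preserves upper
    bounds up to [r]; going backward preserves lower bounds. *)
Lemma Bplus_sublevel {R : realType} {X : Type} {d : X -> X -> R} {f : X -> R}
    (s r : R) : Lip1 d f ->
  Bplus d (f @^-1` `]-oo, s]) r `<=` f @^-1` `]-oo, (s + r)%R[.
Proof.
move=> hf x /ereal_inf_lt[_ [z + <-]]; rewrite /= !in_itv/= lte_fin => fz dzx.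
by have := hf z x; lra.
Qed.

Lemma Bminus_superlevel {R : realType} {X : Type} {d : X -> X -> R}
    {f : X -> R} (t r : R) : Lip1 d f ->
  Bminus d (f @^-1` `]t, +oo[) r `<=` f @^-1` `](t - r)%R, +oo[.
Proof.
move=> hf x /ereal_inf_lt[_ [z + <-]].
rewrite /= !in_itv/= !andbT lte_fin => fz dxz.
by have := hf x z; lra.
Qed.

Theorem theorem4p1 (R : realType) (disp : measure_display)
    (X : measurableType disp) (d : X -> X -> R) (k : ball_kind)
    (mu : probability X R) (hX : irreversible_mm_space d k)
    (eps : R) (heps0 : (0 < eps)%R) (heps1 : (eps < 1)%R) :
  obs_diam d mu eps <= 2%:E * concentration_inv d mu (eps / 2)%R.
Proof.
(* Moving the factor 2 to the left exposes the infimum, so one admissible [r] can be fixed; the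
   factor is then moved back. *)
rewrite -lee_pdivrMl//; apply: le_ereal_inf_tmp => _ [r [r0 hr] <-].
rewrite lee_pdivrMl//; apply: ge_ereal_sup => _ [f hf <-].
apply/lee_addgt0Pr => delta delta0.
have mf := irmm_measurable_Lip1 hX hf.
have mpre (I : set R) : measurable I -> measurable (f @^-1` I).
  by move=> mI; rewrite -[X in measurable X]setTI; exact: mf.
have [s [hs ht]] := exists_approx_median mu mf delta0.
set t := (s - delta)%R in ht.
apply: (@le_trans _ _ (diam `](t - r)%R, (s + r)%R[)); last first.
  apply: le_trans (diam_itvoo _ _) _.
  by rewrite -EFinM -EFinD lee_fin /t; lra.
apply: ereal_inf_lbound; exists `](t - r)%R, (s + r)%R[%classic => //.
split; first exact: measurable_itv.
(* Each half-line contains the image of one neighbourhood, and each may miss mass [eps / 2]. *)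
have -> : `](t - r)%R, (s + r)%R[%classic =
    `]-oo, (s + r)%R[ `&` `](t - r)%R, +oo[.
  apply/predeqP => x; rewrite /= !in_itv/= andbT.
  by split=> [/andP[]|[? ?]] //; exact/andP.
have -> : (1 - eps = 1 - (eps / 2 + eps / 2))%R by lra.
have [ms mt] : measurable (f @^-1` `]-oo, s]) /\ measurable (f @^-1` `]t, +oo[).
  by split; apply: mpre; exact: measurable_itv.
rewrite preimage_setI; apply: probability_setI_ge.
- by apply: mpre; exact: measurable_itv.
- by apply: mpre; exact: measurable_itv.
- have [+ _] := concentration_Bplus_Bminus hX r0 hr ms hs.
  move=> /le_trans; apply; apply: le_measure; rewrite ?inE.
  + by have [] := irmm_measurable_B hX ms r0.
  + by apply: mpre; exact: measurable_itv.
  + exact: Bplus_sublevel.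
- have [_ +] := concentration_Bplus_Bminus hX r0 hr mt ht.
  move=> /le_trans; apply; apply: le_measure; rewrite ?inE.
  + by have [] := irmm_measurable_B hX mt r0.
  + by apply: mpre; exact: measurable_itv.
  + exact: Bminus_superlevel.
Qed.
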